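(* Suppose $H=H(\gamma)$ is a convolutional operator depending on an arbitrary parameter $\gamma$, with the derivative denoted by $H_\gamma:=\frac{\mathrm d}{\mathrm d\gamma}H(\gamma)$. Let $M=(H^{\mathsf T}H+\lambda T^{\mathsf T}T)^{-1}$ and $u=MH^{\mathsf T}b$. Then the value of $\gamma$ which minimizes the SURE criterion $$-N\sigma^2+\|Hu-b\|_2^2+2\sigma^2\,\mathrm{trace}(HMH^{\mathsf T})$$ satisfies $$0=4\sigma^2\lambda\,\mathrm{trace}_{\Re}\big(M^2T^{\mathsf T}TH^{\mathsf T}H_\gamma\big)+4\,b^{\mathsf T}(HMH^{\mathsf T}-I)^{\mathsf T}\,(HMH_\gamma^{\mathsf T})_{\Re}\,(I-HMH^{\mathsf T})\,b,$$ and hence for any $p\in\mathbb R$, $$\gamma=\gamma\left(\frac{-\sigma^2\lambda\,\mathrm{trace}_{\Re}\big(M^2T^{\mathsf T}TH^{\mathsf T}H_\gamma\big)}{b^{\mathsf T}(HMH^{\mathsf T}-I)^{\mathsf T}\,(HMH_\gamma^{\mathsf T})_{\Re}\,(I-HMH^{\mathsf T})\,b}\right)^{p}.$$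
   Context: Images are identified with vectors in $\mathbb R^N$, and $\mathcal F$ denotes the unitary 2D discrete Fourier transform. A convolutional operator is a real $N\times N$ matrix acting as 2D (circular) convolution with a fixed kernel; it has the form $A=\mathcal F^{-1}\hat A\mathcal F$ with $\hat A$ diagonal (possibly complex). The vector $b\in\mathbb R^N$ is the observed blurry noisy image, $\sigma^2$ is the variance of the i.i.d. mean-zero Gaussian noise in $b$, $\lambda$ is the regularization parameter, and $T$ is a regularization operator (e.g. a circulant finite difference operator) such that $T^{\mathsf T}T$ is a convolutional operator. None of $b,\sigma,\lambda,T$ depends on $\gamma$. The matrix $M$ is taken to be a well-defined symmetric positive definite matrix. The vector $u=MH^{\mathsf T}b$ is the Tikhonov-regularized (Wiener filter) solution, i.e. the minimizer over $v$ of $\|Hv-b\|_2^2+\lambda\|Tv\|_2^2$. For a diagonalizable matrix $A\in\mathbb R^{N\times N}$ with diagonalized form $A=S^{-1}\Lambda S$, define $$A_{\Re}:=S^{-1}\,\Re(\Lambda)\,S,\qquad \mathrm{trace}_{\Re}(A):=\Re(\mathrm{trace}(A))=\sum_{j=1}^N\Re(\Lambda_{jj}),$$ where $\Re$ takes the real part (of each entry of $\Lambda$). *)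

(* Defs.v *)
From HB Require Import structures.
From mathcomp Require Export all_boot all_order all_algebra.
From mathcomp Require Export all_classical all_reals all_analysis.
From mathcomp Require Export complex.

Export Order.TTheory GRing.Theory Num.Theory.
Export numFieldNormedType.Exports.
#[export] Set Implicit Arguments.
#[export] Unset Strict Implicit.
#[export] Unset Printing Implicit Defensive.

Local Open Scope ring_scope.

Section Convolution.
Variables (R : realType) (m n : nat).

(* The type 'I_m.+1 carries the group structure of Z/(m+1), so the index
   subtractions below wrap around. *)
Definition circ_conv (k x : 'M[R]_(m.+1, n.+1)) : 'M[R]_(m.+1, n.+1) :=
  \matrix_(i, j) \sum_p \sum_q k (i - p) (j - q) * x p q.

(* An (m+1) x (n+1) image x is identified with the column vector (mxvec x)^T
   of size N = (m+1)(n+1). *)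
Definition is_conv_op (A : 'M[R]_(m.+1 * n.+1)) : Prop :=
  exists k : 'M[R]_(m.+1, n.+1),
    forall x, A *m (mxvec x)^T = (mxvec (circ_conv k x))^T.

End Convolution.

Section RealPart.
Variables (R : realType) (N : nat).

Definition cplx_mx p q (A : 'M[R]_(p, q)) : 'M[R[i]]_(p, q) :=
  map_mx (real_complex R) A.

Definition re_diag (L : 'rV[R[i]]_N) : 'rV[R[i]]_N :=
  map_mx (fun z => real_complex R (complex.Re z)) L.

(* A = S^-1 diag(L) S over the complex numbers. *)
Definition diagonalization (A : 'M[R]_N) (S : 'M[R[i]]_N) (L : 'rV[R[i]]_N) :=
  S \in unitmx /\ cplx_mx A = invmx S *m diag_mx L *m S.

Definition is_re_mx (A B : 'M[R]_N) : Prop :=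
  exists S L, diagonalization A S L /\
              cplx_mx B = invmx S *m diag_mx (re_diag L) *m S.

(* The matrix S^-1 diag(Re L) S, for A = S^-1 diag(L) S.  As A is real, this
   matrix is real, and it is the same for all diagonalizations of A: see
   re_mxE.  The value is 0 if A is not diagonalizable. *)
Definition re_mx (A : 'M[R]_N) : 'M[R]_N :=
  xget 0 [set B | is_re_mx A B]%classic.

Definition re_trace (A : 'M[R]_N) : R := complex.Re (\tr (cplx_mx A)).

Lemma re_diag_indep (S1 S2 : 'M[R[i]]_N) (L1 L2 : 'rV[R[i]]_N) :
  S1 \in unitmx -> S2 \in unitmx ->
  invmx S1 *m diag_mx L1 *m S1 = invmx S2 *m diag_mx L2 *m S2 ->
  invmx S1 *m diag_mx (re_diag L1) *m S1 =
  invmx S2 *m diag_mx (re_diag L2) *m S2.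
Proof.
move=> u1 u2 e.
have [Q QE] : exists Q, Q = S1 *m invmx S2 by eexists.
have S1E : S1 = Q *m S2 by rewrite QE mulmxKV.
have comm : diag_mx L1 *m Q = Q *m diag_mx L2.
  have := congr1 (fun X => S1 *m X *m invmx S2) e.
  by rewrite !mulmxA mulmxV // mul1mx -!mulmxA mulmxV // mulmx1 QE !mulmxA.
have commR : diag_mx (re_diag L1) *m Q = Q *m diag_mx (re_diag L2).
  apply/matrixP => i j; rewrite mul_diag_mx mul_mx_diag !mxE.
  have [->|Q0] := eqVneq (Q i j) 0; first by rewrite mulr0 mul0r.
  move/matrixP/(_ i j) : comm; rewrite mul_diag_mx mul_mx_diag !mxE mulrC.
  by move/(mulfI Q0) => ->; rewrite mulrC.
rewrite [X in _ *m X = _]S1E mulmxA -(mulmxA (invmx S1)) commR QE.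
by rewrite !mulmxA mulVmx // mul1mx.
Qed.

Lemma re_mxE (A : 'M[R]_N) (S : 'M[R[i]]_N) (L : 'rV[R[i]]_N) :
  diagonalization A S L ->
  cplx_mx (re_mx A) = invmx S *m diag_mx (re_diag L) *m S.
Proof.
move=> [Su AE].
set C := invmx S *m diag_mx (re_diag L) *m S.
pose cj := map_mx (@conjc R).
have cjA : cj N N (cplx_mx A) = cplx_mx A.
  by apply/matrixP => i j; rewrite !mxE /= oppr0.
have cjC : cj N N C = C.
  have cSu : cj N N S \in unitmx by rewrite map_unitmx.
  rewrite /C /cj !map_mxM map_invmx map_diag_mx.
  have -> : map_mx (@conjc R) (re_diag L) = re_diag (cj 1 N L).
    apply/matrixP => i j; rewrite !mxE.
    by case: (L i j) => a b /=; rewrite oppr0.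
  apply: re_diag_indep => //.
  by rewrite -AE -cjA AE /cj !map_mxM map_invmx map_diag_mx.
have [B BC] : exists B : 'M[R]_N, cplx_mx B = C.
  move: C cjC => C cjC; exists (map_mx (@complex.Re R) C).
  apply/matrixP => i j; rewrite !mxE.
  have : conjc (C i j) = C i j by rewrite -[in RHS]cjC mxE.
  case: (C i j) => x y /= [] /eqP.
  by rewrite eq_sym -subr_eq0 opprK -mulr2n mulrn_eq0 /= => /eqP ->.
rewrite /re_mx; case: xgetP => [B' _ [S' [L' [[S'u AE'] ->]]]|/(_ B) []].
  by apply: re_diag_indep; rewrite // -AE -AE'.
by exists S, L.
Qed.

End RealPart.

Section Sure.
Variables (R : realType) (N K : nat).
Variables (lambda sigma : R) (T : 'M[R]_(K, N)) (b : 'cV[R]_N).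
Implicit Types H : 'M[R]_N.

Definition sqnorm2 (v : 'cV[R]_N) : R := \sum_i (v i 0) ^+ 2.

Definition posdef (A : 'M[R]_N) : Prop :=
  A^T = A /\ forall v : 'cV[R]_N, v != 0 -> 0 < (v^T *m A *m v) 0 0.

Definition tik_normal H : 'M[R]_N := H^T *m H + lambda *: (T^T *m T).

Definition tik_inv H : 'M[R]_N := invmx (tik_normal H).

Definition tik_sol H : 'cV[R]_N := tik_inv H *m H^T *m b.

Definition sure H : R :=
  - (N%:R * sigma ^+ 2) + sqnorm2 (H *m tik_sol H - b)
  + 2 * sigma ^+ 2 * \tr (H *m tik_inv H *m H^T).

End Sure.

(* Main.v *)
Require Import Defs.
From mathcomp Require Import perm ring lra.

(** A minimizer of the criterion on an open set of parameters is a critical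
    point, so everything comes down to differentiating the criterion and
    recognizing the two terms of its derivative.  Write C for T^T T, X for the
    normal matrix H^T H + lambda C, M for its inverse, P = H M H^T for the
    influence matrix (it sends the data b to the prediction H u), and a prime
    for the derivative with respect to the parameter.

    Convolutions commute with each other and are stable under transposition
    and under differentiation in the parameter (conv_op_comm, conv_op_trmx,
    is_conv_op_derive); hence H, H', C, their transposes and M all commute.
    Moving H past M gives P = M (X - lambda C) = I - lambda M C (influenceE),
    which leaves M as the only factor that depends on the parameter.  With
    M' = - M X' M (is_derive_invmx), this yields

      P' = lambda M X' M C,   X' = H'^T H + H^T H'.

    The criterion is a constant plus |(P - I) b|^2 + 2 sigma^2 tr P, so its
    derivative is 2 b^T (P - I)^T P' b + 2 sigma^2 tr P' (is_derive_sure).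
    The two summands of X' are transposes of each other and contribute equally
    to the trace, so tr P' = 2 lambda tr (M^2 C H^T H') (mxtrace_influence).
    For the quadratic term, lambda M C = I - P and M X' = A + A^T, where
    A = H M H'^T.  The matrix A is real and normal, so a unitary matrix
    diagonalizes it, transposition conjugates its eigenvalues, and A + A^T is
    twice the matrix obtained by taking real parts of the eigenvalues
    (re_mx_normal, influence_conv).  The sum is the announced stationarity
    equation.

    That equation says that the ratio in the fixed-point formula is 1 as soon
    as its denominator is nonzero, and every real power of 1 is 1. *)

Local Open Scope classical_set_scope.
Local Open Scope ring_scope.

(** * Differentiation of matrix-valued functions *)

Lemma is_derive_mxP (R : realFieldType) (V : normedModType R) (m n : nat)
    (A : V -> 'M[R]_(m, n)) (x v : V) (dA : 'M[R]_(m, n)) :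
  is_derive x v A dA <->
  forall i j, is_derive x v (fun y => A y i j) (dA i j).
Proof.
split=> [[drv <-] i j|drv].
  rewrite derive_mx// mxE; apply: derivableP.
  by move/derivable_mxP: drv.
have dvA : derivable A x v.
  by apply/derivable_mxP => i j; case: (drv i j).
apply: DeriveDef => //; rewrite derive_mx//; apply/matrixP => i j.
by rewrite mxE; case: (drv i j).
Qed.

Lemma is_derive_mulmx (R : realFieldType) (V : normedModType R) (m n p : nat)
    (A : V -> 'M[R]_(m, n)) (B : V -> 'M[R]_(n, p)) (x v : V) dA dB :
  is_derive x v A dA -> is_derive x v B dB ->
  is_derive x v (fun y => A y *m B y) (dA *m B x + A x *m dB).
Proof.
move=> /is_derive_mxP drvA /is_derive_mxP drvB; apply/is_derive_mxP => i j.
have -> : (fun y => (A y *m B y) i j) =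
    \sum_k ((fun y => A y i k) * (fun y => B y k j)).
  by apply/funext => y; rewrite mxE fct_sumE.
apply: is_derive_eq; rewrite !mxE -big_split /=; apply: eq_bigr => k _.
by rewrite addrC [dA i k * _]mulrC.
Qed.

Lemma is_derive_trmx (R : realFieldType) (V : normedModType R) (m n : nat)
    (A : V -> 'M[R]_(m, n)) (x v : V) dA :
  is_derive x v A dA -> is_derive x v (fun y => (A y)^T) dA^T.
Proof.
move=> /is_derive_mxP drvA; apply/is_derive_mxP => i j.
by under eq_fun do rewrite mxE; rewrite mxE.
Qed.

Lemma is_derive_mxtrace (R : realFieldType) (V : normedModType R) (n : nat)
    (A : V -> 'M[R]_n) (x v : V) dA :
  is_derive x v A dA -> is_derive x v (fun y => \tr (A y)) (\tr dA).
Proof.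
move=> /is_derive_mxP drvA.
have -> : (fun y => \tr (A y)) = \sum_k (fun y => A y k k).
  by apply/funext => y; rewrite fct_sumE.
exact: is_derive_sum.
Qed.

(** The determinant is a polynomial in the entries (Leibniz formula). *)
Lemma derivable_det (R : realFieldType) (V : normedModType R) (n : nat)
    (A : V -> 'M[R]_n) (x v : V) :
  derivable A x v -> derivable (fun y => \det (A y)) x v.
Proof.
move=> /derivable_mxP drvA.
have -> : (fun y => \det (A y)) =
    \sum_(s : 'S_n) (cst ((-1) ^+ s) * \prod_i (fun y => A y i (s i))).
  apply/funext => y; rewrite fct_sumE /determinant; apply: eq_bigr => s _.
  by rewrite fctE fct_prodE.
apply: (big_ind (fun f : V -> R => derivable f x v)) => [|f g|s _].
- exact: (derivable_cst 0).
- exact: derivableD.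
apply: derivableM; first exact: derivable_cst.
apply: (big_ind (fun f : V -> R => derivable f x v)) => [|f g|i _].
- exact: (derivable_cst (1 : R)).
- exact: derivableM.
exact: drvA.
Qed.

Lemma near_unitmx (R : realFieldType) (n : nat) (A : R -> 'M[R]_n) (x : R) :
  derivable A x 1 -> A x \in unitmx -> \forall y \near x, A y \in unitmx.
Proof.
move=> /derivable_det drv; rewrite unitmxE unitfE => Ax.
have /differentiable_continuous ct : differentiable (fun y => \det (A y)) x.
  exact/derivable1_diffP.
near=> y; rewrite unitmxE unitfE; near: y; exact: (cvgr_neq0 _ ct Ax).
Unshelve. all: by end_near. Qed.

(** Cramer's formula shows that the inverse is differentiable; the value of
    its derivative then comes from differentiating A^-1 A = 1. *)
Lemma is_derive_invmx (R : realFieldType) (n : nat)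
    (A : R -> 'M[R]_n) (x : R) dA :
  is_derive x 1 A dA -> A x \in unitmx ->
  is_derive x 1 (fun y => invmx (A y)) (- (invmx (A x) *m dA *m invmx (A x))).
Proof.
move=> drvA Ax; have dvA : derivable A x 1 by [].
have Aunit := near_unitmx dvA Ax.
have dvV : derivable (fun y => invmx (A y)) x 1.
  apply: (@near_eq_derivable _ _ _ (fun y => (\det (A y))^-1 *: \adj (A y))).
    by near=> y; rewrite /invmx ifT//; near: y.
  apply/derivable_mxP => i j; under eq_fun do rewrite mxE mxE.
  apply: derivableM.
    by apply: derivableV; [rewrite -unitfE -unitmxE|exact: derivable_det].
  apply: derivableM; first exact: derivable_cst.
  apply: derivable_det; apply/derivable_mxP => k l.
  under eq_fun do rewrite !mxE.
  by have /derivable_mxP := dvA; apply.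
have := derivableP dvV; set dV := (X in is_derive _ _ _ X) => drvV.
have drv1 : is_derive x 1 (fun y => invmx (A y) *m A y) 0.
  apply: (near_eq_is_derive (f := cst 1%:M)).
  by near=> y; rewrite /= mulVmx//; near: y.
have [_ /esym] := is_derive_mulmx drvV drvA; case: drv1 => _ ->.
move/eqP; rewrite addr_eq0 => /eqP dVE.
suff <- : dV = - (invmx (A x) *m dA *m invmx (A x)) by exact: drvV.
by rewrite -mulNmx -dVE mulmxK.
Unshelve. all: by end_near. Qed.

(** * Convolution operators *)

(** The defining property of a convolution only constrains the action on
    images; testing it on unit impulses makes it a condition on the entries,
    for which transposition and differentiation are immediate. *)
Lemma is_conv_opP (R : realType) (m n : nat) (A : 'M[R]_(m.+1 * n.+1)) :
  is_conv_op A <->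
  exists k : 'M[R]_(m.+1, n.+1), forall i j p q,
    A (mxvec_index i j) (mxvec_index p q) = k (i - p) (j - q).
Proof.
split=> [] [k Ak]; exists k.
  move=> i j p q.
  have := Ak (delta_mx p q); rewrite mxvec_delta trmx_delta -colE.
  move/matrixP/(_ (mxvec_index i j) 0); rewrite mxE [RHS]mxE mxvecE mxE => ->.
  rewrite (bigD1 p)//= (bigD1 q)//= !mxE !eqxx mulr1 !big1 ?addr0// => r rp.
    by rewrite big1// => s _; rewrite mxE (negbTE rp) mulr0.
  by rewrite mxE (negbTE rp) andbF mulr0.
move=> x; apply/colP => u; case/mxvec_indexP: u => i j.
rewrite mxE [RHS]mxE mxvecE mxE.
rewrite (reindex _ (curry_mxvec_bij _ _)) pair_bigA /=.
by apply: eq_bigr => -[p q] _ /=; rewrite Ak mxE mxvecE.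
Qed.

Lemma conv_op_comm (R : realType) (m n : nat) (A B : 'M[R]_(m.+1 * n.+1)) :
  is_conv_op A -> is_conv_op B -> comm_mx A B.
Proof.
move=> /is_conv_opP[a Aa] /is_conv_opP[b Bb]; apply/matrixP => u v.
case/mxvec_indexP: u => i j; case/mxvec_indexP: v => p q; rewrite !mxE.
rewrite !(reindex _ (curry_mxvec_bij _ _)) /=.
(* The reflection r |-> i + p - r swaps the differences i - r and r - p. *)
pose refl (rs : 'I_m.+1 * 'I_n.+1) := (i + p - rs.1, j + q - rs.2).
have reflK : involutive refl by move=> [r s]; rewrite /refl /= !subKr.
rewrite (reindex_inj (inv_inj reflK)).
apply: eq_bigr => -[r s] _ /=; rewrite !Aa !Bb mulrC.
have firstE t (x y z : 'I_t.+1) : x + y - z - y = x - z.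
  by rewrite addrAC addrK.
have secondE t (x y z : 'I_t.+1) : x - (x + y - z) = z - y.
  by rewrite opprB addrCA opprD addNKr.
by congr (b _ _ * a _ _); rewrite ?firstE ?secondE.
Qed.

Lemma conv_op_trmx (R : realType) (m n : nat) (A : 'M[R]_(m.+1 * n.+1)) :
  is_conv_op A -> is_conv_op A^T.
Proof.
move=> /is_conv_opP[a Aa]; apply/is_conv_opP.
exists (\matrix_(i, j) a (- i) (- j)) => i j p q.
by rewrite !mxE Aa !opprB.
Qed.

(** Translation invariance is a family of equalities between entries, and
    entries that agree near a point have equal derivatives there. *)
Lemma is_conv_op_derive (R : realType) (m n : nat)
    (H : R -> 'M[R]_(m.+1 * n.+1)) (x : R) dH :
  (\forall y \near x, is_conv_op (H y)) -> is_derive x 1 H dH -> is_conv_op dH.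
Proof.
move=> convH /is_derive_mxP drvH; apply/is_conv_opP.
exists (\matrix_(i, j) dH (mxvec_index i j) (mxvec_index 0 0)) => i j p q.
rewrite mxE.
have [_ <-] := drvH (mxvec_index i j) (mxvec_index p q).
have [_ <-] := drvH (mxvec_index (i - p) (j - q)) (mxvec_index 0 0).
apply: near_eq_derive; near=> y.
have /is_conv_opP[k Hk] : is_conv_op (H y) by near: y.
by rewrite !Hk !subr0.
Unshelve. all: by end_near. Qed.

(** * Real parts of matrices *)

Lemma normalmx_adj_spectral (C : numClosedFieldType) (n : nat) (A : 'M[C]_n) :
  A \is normalmx ->
  map_mx Num.conj A^T = invmx (spectralmx A)
    *m diag_mx (map_mx Num.conj (spectral_diag A)) *m spectralmx A.
Proof.
move=> /orthomx_spectralP; have := spectral_unitarymx A.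
set P := spectralmx A; set L := spectral_diag A => uP AE.
rewrite [in LHS]AE invmx_unitary// !trmx_mul !map_mxM.
by rewrite tr_diag_mx map_diag_mx [X in _ *m (_ *m X)]trmxCK mulmxA.
Qed.

(** A unitary matrix diagonalizes the normal matrix A, and it diagonalizes the
    adjoint of A with the conjugate eigenvalues.  As A is real, this adjoint is
    A^T, and the mean of an eigenvalue and its conjugate is its real part. *)
Lemma re_mx_normal (R : realType) (N : nat) (A : 'M[R]_N) :
  comm_mx A A^T -> re_mx A = 2^-1 *: (A + A^T).
Proof.
move=> AAT.
have adjE : map_mx Num.conj (cplx_mx A)^T = cplx_mx A^T.
  by apply/matrixP => i j; rewrite !mxE; exact: conjc_real.
have nA : cplx_mx A \is normalmx.
  by apply/normalmxP; rewrite adjE -!map_mxM AAT.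
have ATE := normalmx_adj_spectral nA; rewrite adjE in ATE.
have /orthomx_spectralP AE := nA.
set P := spectralmx _ in AE ATE; set L := spectral_diag _ in AE ATE.
have uP : P \is unitarymx by exact: spectral_unitarymx.
have dA : diagonalization A P L.
  by split; [exact: unitarymx_unit|exact: AE].
apply: (map_mx_inj (f := real_complex R)).
rewrite -/(cplx_mx _) (re_mxE dA) map_mxZ map_mxD -!/(cplx_mx _) ATE [in RHS]AE.
rewrite -mulmxDl -mulmxDr -raddfD scalemxAl scalemxAr -linearZ.
congr (_ *m diag_mx _ *m _); apply/rowP => i; rewrite !mxE.
case: (L 0 i) => a c; apply/eqP; rewrite eq_complex /=.
by rewrite subrr !mul0r mulr0 addr0 subr0 -mulr2n -[a *+ 2]mulr_natl mulKf ?eqxx//.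
Qed.

Lemma re_traceE (R : realType) (n : nat) (A : 'M[R]_n) : re_trace A = \tr A.
Proof. by rewrite /re_trace trace_map_mx. Qed.

(** * Tikhonov regularization and the risk estimate *)

Lemma comm_mx_invmx (R : comUnitRingType) (n : nat) (A B : 'M[R]_n) :
  comm_mx A B -> comm_mx A (invmx B).
Proof.
have [Bu|] := boolP (B \in unitmx); last by move=> Bn; rewrite /invmx (negbTE Bn).
move=> AB; rewrite /comm_mx -[LHS](mulKmx Bu).
by rewrite (mulmxA B) -AB mulmxK.
Qed.

(** The hat matrix of Tikhonov regularization, which sends the data b to the
    prediction H u. *)
Definition influence (R : realType) (N K : nat) (lambda : R) (T : 'M[R]_(K, N))
  (H : 'M[R]_N) : 'M[R]_N := H *m tik_inv lambda T H *m H^T.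

Section Tikhonov.
Variables (R : realType) (N K : nat) (lambda : R) (T : 'M[R]_(K, N)).
Implicit Types H : 'M[R]_N.

Lemma tik_inv_sym H : (tik_inv lambda T H)^T = tik_inv lambda T H.
Proof.
by rewrite /tik_inv trmx_inv linearD linearZ /= !trmx_mul !trmxK.
Qed.

Lemma comm_tik_inv A H :
  comm_mx A H -> comm_mx A H^T -> comm_mx A (T^T *m T) ->
  comm_mx A (tik_inv lambda T H).
Proof.
move=> AH AHT AC; apply/comm_mx_invmx/comm_mxD; first exact: comm_mxM.
by rewrite /comm_mx -scalemxAr AC -scalemxAl.
Qed.

(** Once H is moved to the right of the inverse, H H^T = H^T H can be
    completed to the normal matrix, which the inverse cancels.  The parameter
    then enters through the inverse only. *)
Lemma influenceE H :
  tik_normal lambda T H \in unitmx ->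
  comm_mx H H^T -> comm_mx H (T^T *m T) ->
  influence lambda T H = 1%:M - lambda *: (tik_inv lambda T H *m (T^T *m T)).
Proof.
move=> Xu HHT HC; rewrite /influence.
have -> : H *m tik_inv lambda T H = tik_inv lambda T H *m H.
  exact: comm_tik_inv.
rewrite -mulmxA HHT.
have -> : H^T *m H = tik_normal lambda T H - lambda *: (T^T *m T).
  by rewrite addrK.
by rewrite mulmxBr mulVmx// -scalemxAr.
Qed.

Lemma sureE (sigma : R) (b : 'cV[R]_N) H :
  sure lambda sigma T b H =
  - (N%:R * sigma ^+ 2) + sqnorm2 ((influence lambda T H - 1%:M) *m b)
  + 2 * sigma ^+ 2 * \tr (influence lambda T H).
Proof. by rewrite mulmxBl mul1mx /influence /sure /tik_sol !mulmxA. Qed.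

Lemma is_derive_sqnorm2 (r : R -> 'cV[R]_N) (x : R) dr :
  is_derive x 1 r dr ->
  is_derive x 1 (fun y => sqnorm2 (r y)) (2 * ((r x)^T *m dr) 0 0).
Proof.
move=> /is_derive_mxP drv.
have -> : (fun y => sqnorm2 (r y)) = \sum_i (fun y => r y i 0) ^+ 2.
  by apply/funext => y; rewrite fct_sumE.
apply: is_derive_eq; rewrite mxE mulr_sumr; apply: eq_bigr => i _.
by rewrite mxE expr1 mulrA.
Qed.

Lemma is_derive_tik_normal (H : R -> 'M[R]_N) (x : R) dH :
  is_derive x 1 H dH ->
  is_derive x 1 (fun y => tik_normal lambda T (H y))
    (dH^T *m H x + (H x)^T *m dH).
Proof.
move=> drv; rewrite -[X in is_derive _ _ _ X]addr0.
apply: is_deriveD.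
by apply: is_derive_mulmx => //; exact: is_derive_trmx.
Qed.

Lemma is_derive_sure sigma b (H : R -> 'M[R]_N) (x : R) dP :
  is_derive x 1 (fun y => influence lambda T (H y)) dP ->
  is_derive x 1 (fun y => sure lambda sigma T b (H y))
    (2 * (b^T *m (influence lambda T (H x) - 1%:M)^T *m dP *m b) 0 0
     + 2 * sigma ^+ 2 * \tr dP).
Proof.
move=> drv; under eq_fun do rewrite sureE.
have drvr : is_derive x 1
    (fun y => (influence lambda T (H y) - 1%:M) *m b) (dP *m b).
  apply: is_derive_eq.
    by apply: is_derive_mulmx; apply: is_derive_cst.
  by rewrite subr0 mulmx0 addr0.
have drvs := is_derive_sqnorm2 drvr; have drvt := is_derive_mxtrace drv.
by apply: is_derive_eq; rewrite add0r mul1r trmx_mul !mulmxA.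
Qed.

Lemma is_derive_influence (H : R -> 'M[R]_N) (x : R) dH :
  tik_normal lambda T (H x) \in unitmx ->
  (\forall y \near x, comm_mx (H y) (H y)^T) ->
  (\forall y \near x, comm_mx (H y) (T^T *m T)) ->
  is_derive x 1 H dH ->
  is_derive x 1 (fun y => influence lambda T (H y))
    (lambda *: (tik_inv lambda T (H x) *m (dH^T *m H x + (H x)^T *m dH)
                *m tik_inv lambda T (H x) *m (T^T *m T))).
Proof.
move=> Xu HHT HC /is_derive_tik_normal drvX.
have nearXu : \forall y \near x, tik_normal lambda T (H y) \in unitmx.
  by apply: near_unitmx => //; case: drvX.
have drvM := is_derive_invmx drvX Xu.
apply: (near_eq_is_derive
  (f := fun y => 1%:M - lambda *: (tik_inv lambda T (H y) *m (T^T *m T)))).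
  by near=> y; rewrite influenceE//; near: y.
have drvMC := is_derive_mulmx drvM (is_derive_cst (T^T *m T) x 1).
apply: is_derive_eq.
by rewrite mulmx0 addr0 sub0r mulNmx scalerN opprK.
Unshelve. all: by end_near. Qed.

End Tikhonov.

(** The left-hand side is the derivative of the influence matrix P given by
    is_derive_influence.  There lambda M C = 1 - P, and M (dh^T h + h^T dh) is
    the sum of A = h M dh^T and its transpose, that is twice the real part of
    the normal matrix A. *)
Lemma influence_conv (R : realType) (m n K : nat) (lambda : R)
    (T : 'M[R]_(K, m.+1 * n.+1)) (h dh : 'M[R]_(m.+1 * n.+1)) :
  is_conv_op h -> is_conv_op dh -> is_conv_op (T^T *m T) ->
  tik_normal lambda T h \in unitmx ->
  let M := tik_inv lambda T h in
  lambda *: (M *m (dh^T *m h + h^T *m dh) *m M *m (T^T *m T)) =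
  2 *: (re_mx (h *m M *m dh^T) *m (1%:M - h *m M *m h^T)).
Proof.
move=> ch cdh cC Xu M.
have chT := conv_op_trmx ch; have cdhT := conv_op_trmx cdh.
have commM A : is_conv_op A -> comm_mx A M.
  by move=> cA; apply: comm_tik_inv; apply: conv_op_comm.
have AT : (h *m M *m dh^T)^T = dh *m M *m h^T.
  by rewrite !trmx_mul trmxK tik_inv_sym mulmxA.
rewrite re_mx_normal AT; last first.
  (* A is normal because h, dh, their transposes and M all commute. *)
  have commA A : comm_mx A dh -> comm_mx A M -> comm_mx A h^T ->
      comm_mx A (dh *m M *m h^T).
    by move=> Adh AM AhT; do 2?apply: comm_mxM.
  by do 2?[apply: comm_mx_sym; apply: comm_mxM; apply: comm_mx_sym];
    apply: commA; do ?[exact: commM | exact: conv_op_comm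
                      | exact: comm_mx_refl | apply: comm_mx_sym].
have -> : 1%:M - h *m M *m h^T = lambda *: (M *m (T^T *m T)).
  rewrite -/(influence lambda T h) influenceE//; try exact: conv_op_comm.
  by rewrite subKr.
have -> : M *m (dh^T *m h + h^T *m dh) = h *m M *m dh^T + dh *m M *m h^T.
  rewrite mulmxDr (conv_op_comm cdhT ch) (conv_op_comm chT cdh) !mulmxA.
  by rewrite -(commM _ ch) -(commM _ cdh).
rewrite -scalemxAl scalerA divff ?pnatr_eq0// scale1r -scalemxAr.
by rewrite -[in LHS]mulmxA.
Qed.

(** By cyclicity the trace is that of (dh^T h + h^T dh) Q, where Q = M C M is
    symmetric: the two summands are transposes up to a cyclic shift. *)
Lemma mxtrace_influence (R : realType) (N K : nat) (lambda : R)
    (T : 'M[R]_(K, N)) (h dh : 'M[R]_N) :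
  let M := tik_inv lambda T h in
  comm_mx (T^T *m T) M ->
  \tr (M *m (dh^T *m h + h^T *m dh) *m M *m (T^T *m T)) =
  2 * \tr (M *m M *m T^T *m T *m h^T *m dh).
Proof.
move=> M CM.
have QT : (M *m (T^T *m T) *m M)^T = M *m (T^T *m T) *m M.
  by rewrite !trmx_mul trmxK tik_inv_sym !mulmxA.
set Q := M *m (T^T *m T) *m M in QT.
have -> : M *m M *m T^T *m T *m h^T *m dh = Q *m (h^T *m dh).
  by rewrite /Q -[M *m (T^T *m T) *m M]mulmxA CM !mulmxA.
transitivity (\tr ((dh^T *m h + h^T *m dh) *m Q)).
  by rewrite -!mulmxA mxtrace_mulC /Q !mulmxA.
rewrite mulmxDl mxtraceD mulr_natl mulr2n; congr (_ + _).
  by rewrite -mxtrace_tr trmx_mul QT trmx_mul trmxK.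
by rewrite mxtrace_mulC.
Qed.

(** * Stationarity of the criterion at a minimizer *)

Theorem theorem2 (R : realType) (m n K : nat)
  (lambda sigma : R) (T : 'M[R]_(K, m.+1 * n.+1)) (b : 'cV[R]_(m.+1 * n.+1))
  (D : set R) (H : R -> 'M[R]_(m.+1 * n.+1)) (gamma : R)
  (hT : is_conv_op (T^T *m T))
  (D_open : open D)
  (H_conv : forall g, D g -> is_conv_op (H g))
  (H_der : forall g, D g -> derivable H g 1)
  (M_def : forall g, D g -> tik_normal lambda T (H g) \in unitmx)
  (M_pos : forall g, D g -> posdef (tik_inv lambda T (H g)))
  (gammaD : D gamma)
  (gamma_min : forall g, D g ->
     sure lambda sigma T b (H gamma) <= sure lambda sigma T b (H g)) :
  let h := H gamma in
  let dh := (H^`())%classic gamma in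
  let M := tik_inv lambda T h in
  let tr := re_trace (M *m M *m T^T *m T *m h^T *m dh) in
  let q := (b^T *m (h *m M *m h^T - 1%:M)^T *m re_mx (h *m M *m dh^T)
            *m (1%:M - h *m M *m h^T) *m b) 0 0 in
  0 = 4 * sigma ^+ 2 * lambda * tr + 4 * q
  /\ (q != 0 -> forall p : R,
        gamma = gamma * ((- (sigma ^+ 2 * lambda * tr) / q) `^ p)).
Proof.
move=> h dh M tr q.
have D_near g : D g -> \forall y \near g, D y.
  by move=> Dg; exact: open_nbhs_nbhs.
have H_is_der g : D g -> is_derive g 1 H ((H^`())%classic g).
  by move=> Dg; rewrite derive1E; apply: derivableP; exact: H_der.
have dH_conv g : D g -> is_conv_op ((H^`())%classic g).
  move=> Dg; apply: is_conv_op_derive (H_is_der g Dg).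
  by apply: filterS (D_near g Dg) => y; exact: H_conv.
have P_der g : D g -> is_derive g 1 (fun y => influence lambda T (H y))
    (lambda *: (tik_inv lambda T (H g)
       *m (((H^`())%classic g)^T *m H g + (H g)^T *m (H^`())%classic g)
       *m tik_inv lambda T (H g) *m (T^T *m T))).
  move=> Dg; apply: is_derive_influence (H_is_der g Dg); first exact: M_def.
    apply: filterS (D_near g Dg) => y Dy.
    by apply: conv_op_comm; [|apply: conv_op_trmx]; exact: H_conv.
  apply: filterS (D_near g Dg) => y Dy.
  by apply: conv_op_comm => //; exact: H_conv.
have sure_der0 : is_derive gamma 1 (fun y => sure lambda sigma T b (H y)) 0.
  have [e e0 eD] : exists2 e : R, 0 < e &
      forall y, y \in `]gamma - e, gamma + e[ -> D y.
    have /nbhs_ballP[e /= e0 eD] := D_near _ gammaD; exists e => // y ye.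
    by apply: eD; rewrite ball_itv.
  apply: (@derive1_at_min _ _ (gamma - e) (gamma + e)).
  - by rewrite lerD2l ge0_cp// ltW.
  - by move=> t /eD Dt; have [] := is_derive_sure sigma b (P_der t Dt).
  - by rewrite in_itv /= ltrDl e0 gtrBl e0.
  - by move=> t /eD; exact: gamma_min.
have hc : is_conv_op h by exact: H_conv.
have stationary : 0 = 4 * sigma ^+ 2 * lambda * tr + 4 * q.
  have [_ <-] := sure_der0.
  have [_ ->] := is_derive_sure sigma b (P_der gamma gammaD).
  rewrite mxtraceZ mxtrace_influence -/h -/dh; last first.
    by apply: comm_tik_inv; apply: conv_op_comm => //; exact: conv_op_trmx.
  rewrite (influence_conv hc _ hT); [|exact: dH_conv|exact: M_def].
  rewrite /tr re_traceE -/M /influence -/M.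
  rewrite -scalemxAr -scalemxAl mxE !mulmxA -/q.
  by ring.
split=> // q0 p.
suff -> : - (sigma ^+ 2 * lambda * tr) / q = 1 by rewrite powR1 mulr1.
suff -> : - (sigma ^+ 2 * lambda * tr) = q by rewrite divff.
by lra.
Qed.
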